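(* Let $D=(P,\mathcal{B})$ be a non-trivial $(v,k,2)$-biplane and let $\Gamma_2(D)$ be the graph on the flags of $D$ in which $(p,c)$ and $(q,d)$ are adjacent if and only if $c\cap d=\{p,q\}$. Then $\Gamma_2(D)$ is a $(vk,\,k-1,\,0;\,0,1,2)$-QSRG.
   Context: Let $v,k$ be positive integers with $k>1$. A $(v,k,2)$-biplane is a $(v,k,2)$-symmetric design, i.e. a pair $D=(P,\mathcal{B})$ where $P$ is a set of $v$ points, $\mathcal{B}$ is a set of $v$ blocks, each block is a $k$-subset of $P$ (so there are no repeated blocks), and every unordered pair of distinct points is contained in exactly $2$ blocks; every point then lies in exactly $k$ blocks. $D$ is non-trivial if $v-k>1$. A flag of $D$ is an ordered pair $(p,c)$ with $p\in P$, $c\in\mathcal{B}$ and $p\in c$. The graph $\Gamma_2(D)$ has the flags of $D$ as its vertices, two vertices $(p,c)$ and $(q,d)$ being adjacent if and only if $c\cap d=\{p,q\}$. An $(n,t,\eta;\mu_1,\ldots,\mu_s)$-quasi-strongly regular graph (QSRG) is a graph on $n$ vertices that is $t$-regular, in which any two adjacent vertices have exactly $\eta$ common neighbours, and the number of common neighbours of any two distinct non-adjacent vertices belongs to $\{\mu_1,\ldots,\mu_s\}$ (it is not required that every value $\mu_i$ occurs). *)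

(* Defs.v *)
(* Mathematical Components. *)
From mathcomp Require Import all_boot.

Set Implicit Arguments.
Unset Strict Implicit.
Unset Printing Implicit Defensive.

(* The point set is the whole finite type P, and a design on P is given by its
   set of blocks B; as B is a set of sets, there are no repeated blocks. *)
Definition symmetric_design (P : finType) (B : {set {set P}})
    (v k lambda : nat) : Prop :=
  [/\ #|P| = v,
      #|B| = v,
      forall b : {set P}, b \in B -> #|b| = k
    & forall x y : P, x != y ->
        #|[set b in B | (x \in b) && (y \in b)]| = lambda].

Definition biplane (P : finType) (B : {set {set P}}) (v k : nat) : Prop :=
  [/\ 0 < v, 1 < k & symmetric_design B v k 2].

(* For a biplane k <= v, so truncated subtraction is harmless here. *)
Definition nontrivial (v k : nat) : Prop := 1 < v - k.

Definition flag (P : finType) (B : {set {set P}}) : Type :=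
  {f : P * {set P} | (f.2 \in B) && (f.1 \in f.2)}.

Definition point (P : finType) (B : {set {set P}}) (f : flag B) : P :=
  (val f).1.

Definition block (P : finType) (B : {set {set P}}) (f : flag B) : {set P} :=
  (val f).2.

Definition Gamma2 (P : finType) (B : {set {set P}}) : rel (flag B) :=
  fun f g => block f :&: block g == [set point f; point g].

Section Graph.

Variables (V : finType) (e : rel V).

Definition simple_graph : Prop := symmetric e /\ irreflexive e.

Definition regular (t : nat) : Prop :=
  forall x : V, #|[set y | e x y]| = t.

Definition common_neighbours (x y : V) : {set V} := [set z | e x z & e y z].

Definition qsrg (n t eta : nat) (mus : seq nat) : Prop :=
  [/\ simple_graph,
      #|V| = n,
      regular t,
      forall x y : V, e x y -> #|common_neighbours x y| = eta
    & forall x y : V, x != y -> ~~ e x y -> #|common_neighbours x y| \in mus].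

End Graph.

(* Main.v *)
Require Import Defs.
From mathcomp Require Import all_boot.
From mathcomp Require Import zify.

Set Implicit Arguments.
Unset Strict Implicit.
Unset Printing Implicit Defensive.

(** The theorem rests on three facts about a non-trivial biplane: every point
    lies on [k] blocks ([point_degree]), any two blocks share exactly two
    points ([block_intersection]), and [k > 2] ([nontrivial_block_size]).

    By the second and third facts, adjacent flags have distinct blocks and
    distinct points, so a neighbour [(q, d)] of [(p, c)] amounts to a block
    [d != c] through [p]: the point [q] is then the other point of [c] and [d].
    There are [k - 1] such blocks, which gives the degree, and sending a
    neighbour to its block is injective on each neighbourhood.

    The block of a common neighbour of [(p, c)] and [(q, d)] passes through [p]
    and [q].  If [p != q], only two blocks do, so there are at most two common
    neighbours; if moreover the flags are adjacent, those two blocks are [c] and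
    [d] themselves, and neither can be the block of a neighbour.  If [p = q] and
    [c != d], a common neighbour [(r, e)] would give three distinct blocks [c],
    [d], [e] through the distinct points [p] and [r], which is one too many.

    The second fact is a variance argument.  For a fixed block [c], double
    counting yields the first two moments of [#|c :&: d|] over the blocks
    [d != c], and they say that the sum of [(#|c :&: d| - lambda)^2] vanishes. *)

(** * Counting in symmetric designs *)

Lemma double_counting (S T : finType) (A : {pred S}) (C : {pred T})
    (R : S -> T -> bool) :
  \sum_(x in A) #|[set y in C | R x y]| = \sum_(y in C) #|[set x in A | R x y]|.
Proof.
under eq_bigr do rewrite -sum1dep_card big_mkcondr.
rewrite exchange_big; apply: eq_bigr => y _.
by rewrite -sum1dep_card big_mkcondr.
Qed.

Section SymmetricDesign.

Variables (P : finType) (B : {set {set P}}) (v k lambda : nat).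
Hypothesis designB : symmetric_design B v k lambda.

Let points_card : #|P| = v. Proof. by case: designB. Qed.
Let blocks_card : #|B| = v. Proof. by case: designB. Qed.
Let block_card b : b \in B -> #|b| = k.
Proof. by case: designB => _ _ H _; apply: H. Qed.
Let join_card x y : x != y -> #|[set b in B | (x \in b) && (y \in b)]| = lambda.
Proof. by case: designB => _ _ _ H; apply: H. Qed.

(** Double counting of the pairs [(y, b)] where the block [b] passes through [x]
    and [y != x]. *)
Lemma point_degree_mul (x : P) :
  #|[set b in B | x \in b]| * k.-1 = lambda * v.-1.
Proof.
have := @double_counting _ _ (mem [set~ x]) (mem [set b in B | x \in b])
          (fun y b => y \in b).
rewrite (eq_bigr (fun=> lambda)); last first.
  move=> y; rewrite !inE eq_sym => /join_card <-.
  by apply: eq_card => b; rewrite !inE andbA.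
rewrite sum_nat_const cardsC1 points_card [RHS](eq_bigr (fun=> k.-1)).
  by rewrite sum_nat_const [LHS]mulnC => ->.
move=> b; rewrite inE => /andP[bB xb].
rewrite -(block_card bB) (cardsD1 x b) xb.
by apply: eq_card => y; rewrite !inE.
Qed.

Hypothesis k_gt1 : 1 < k.

(** All points have the same degree by [point_degree_mul], and the average
    degree is [k] because there are as many blocks as points. *)
Lemma point_degree (x : P) : #|[set b in B | x \in b]| = k.
Proof.
have v_gt0 : 0 < v by rewrite -points_card; apply/card_gt0P; exists x.
have := @double_counting _ _ (mem [set: P]) (mem B) (fun y b => y \in b).
rewrite (eq_bigr (fun=> #|[set b in B | x \in b]|)); last first.
  move=> y _; apply/eqP; rewrite -(@eqn_pmul2r k.-1); last by lia.
  by rewrite !point_degree_mul.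
rewrite sum_nat_const cardsT points_card [RHS](eq_bigr (fun=> k)).
  by rewrite sum_nat_const blocks_card => /eqP; rewrite eqn_pmul2l // => /eqP.
by move=> b bB; rewrite -(block_card bB); apply: eq_card => y; rewrite !inE.
Qed.

Lemma block_size_mul : 0 < v -> k * k.-1 = lambda * v.-1.
Proof.
rewrite -points_card => /card_gt0P[x _].
by rewrite points_card -(point_degree_mul x) point_degree.
Qed.

Lemma sum_block_intersection (c : {set P}) :
  c \in B -> \sum_(d in B) #|c :&: d| = k * k.
Proof.
move=> cB; rewrite -{1}(block_card cB) -sum_nat_const.
have := @double_counting _ _ (mem c) (mem B) (fun y b => y \in b).
under eq_bigr do rewrite point_degree.
move=> ->; apply: eq_bigr => d _.
by apply: eq_card => y; rewrite !inE.
Qed.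

(** Counts the triples [(x, y, d)] with [x] and [y] in both [c] and [d]: for
    given [x], there are [k] blocks [d] when [y = x], and [lambda] for each
    of the other [k.-1] points [y] of [c]. *)
Lemma sum_sqr_block_intersection (c : {set P}) :
  c \in B -> \sum_(d in B) #|c :&: d| ^ 2 = k * (k + k.-1 * lambda).
Proof.
move=> cB; rewrite -{1}(block_card cB) -sum_nat_const.
transitivity (\sum_(x in c) \sum_(d in [set d in B | x \in d]) #|c :&: d|).
  rewrite (exchange_big_dep (mem B)) /=; last by move=> x d _; rewrite inE => /andP[].
  apply: eq_bigr => d dB; rewrite -mulnn -sum_nat_const.
  by apply: eq_bigl => x; rewrite !inE dB.
apply: eq_bigr => x xc.
have := @double_counting _ _ (mem c) (mem [set d in B | x \in d]) (fun y b => y \in b).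
rewrite [RHS](eq_bigr (fun d : {set P} => #|c :&: d|)); last first.
  by move=> d _; apply: eq_card => y; rewrite !inE.
rewrite (bigD1 x) //= => <-; congr (_ + _).
  rewrite -(point_degree x); apply: eq_card => d.
  by rewrite !inE -andbA andbb.
rewrite (eq_bigr (fun=> lambda)).
  rewrite sum_nat_const -(block_card cB) (cardsD1 x c) xc; congr (_ * _).
  by apply: eq_card => y; rewrite !inE andbC.
move=> y /andP[_]; rewrite eq_sym => /join_card <-.
by apply: eq_card => d; rewrite !inE andbA.
Qed.

(** Over the [v.-1] blocks [d != c], the sums of [#|c :&: d|] and of its square
    are [lambda * v.-1] and [lambda ^ 2 * v.-1].  This is the equality case of
    [2 * (m * lambda) <= m ^ 2 + lambda ^ 2] summed over [m = #|c :&: d|]. *)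
Lemma block_intersection (c d : {set P}) :
  c \in B -> d \in B -> c != d -> #|c :&: d| = lambda.
Proof.
move=> cB dB cd.
have v_gt0 : 0 < v by rewrite -blocks_card; apply/card_gt0P; exists c.
have sz := block_size_mul v_gt0.
have others_card : \sum_(b in B | b != c) 1 = v.-1.
  by have := sum1_card (mem B); rewrite (bigD1 c) //= blocks_card => <-.
have s1 : \sum_(b in B | b != c) #|c :&: b| = lambda * v.-1.
  have := sum_block_intersection cB; rewrite (bigD1 c) //= setIid block_card //.
  by move=> /(canRL (addKn _)) ->; nia.
have s2 : \sum_(b in B | b != c) #|c :&: b| ^ 2 = lambda ^ 2 * v.-1.
  have := sum_sqr_block_intersection cB; rewrite (bigD1 c) //= setIid block_card //.
  by move=> /(canRL (addKn _)) ->; rewrite -!mulnn mulnDr addKn -mulnA -sz; lia.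
have [_] := leqif_sum (fun b (_ : (b \in B) && (b != c)) => nat_Cauchy #|c :&: b| lambda).
rewrite -big_distrr -big_distrl big_split /= s1 s2 sum_nat_cond_const -sum1dep_card others_card.
have -> : 2 * (lambda * v.-1 * lambda) = lambda ^ 2 * v.-1 + v.-1 * lambda ^ 2 by lia.
rewrite eqxx => /esym/forall_inP/(_ d); rewrite dB eq_sym cd => /(_ isT)/eqP.
by [].
Qed.

End SymmetricDesign.

(** * Flags of a biplane *)

Lemma flag_card (P : finType) (B : {set {set P}}) :
  #|{: flag B}| = \sum_(b in B) #|b|.
Proof.
rewrite card_sig -sum1_card.
rewrite (eq_bigl (fun f : P * {set P} => (f.2 \in B) && (f.1 \in f.2))) //.
rewrite -(pair_big_dep xpredT (fun x b => (b \in B) && (x \in b)) (fun _ _ => 1)) /=.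
rewrite (exchange_big_dep (mem B)) /=; last by move=> x b _ /andP[].
by apply: eq_bigr => b bB; rewrite -sum1_card; apply: eq_bigl => x; rewrite bB.
Qed.

Section Biplane.

Variables (P : finType) (B : {set {set P}}) (v k : nat).
Hypotheses (biplaneB : biplane B v k) (nontrivialB : nontrivial v k).

Let designB : symmetric_design B v k 2. Proof. by case: biplaneB. Qed.
Let k_gt1 : 1 < k. Proof. by case: biplaneB. Qed.

(** If [k = 2], then [k * (k - 1) = 2 * (v - 1)] gives [v = 2], and then
    [v - k = 0]. *)
Lemma nontrivial_block_size : 2 < k.
Proof.
have [v_gt0 _ _] := biplaneB; have := block_size_mul designB k_gt1 v_gt0.
by move: nontrivialB; rewrite /nontrivial; nia.
Qed.

Lemma third_block (p q : P) (c d e : {set P}) :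
  p != q -> c != d -> c \in B -> d \in B -> e \in B ->
  p \in c -> q \in c -> p \in d -> q \in d -> p \in e -> q \in e ->
  (e == c) || (e == d).
Proof.
move=> pq cd cB dB eB pc qc pd qd pe qe.
have [_ _ _ join] := designB.
have /eqP pair : [set c; d] == [set b in B | (p \in b) && (q \in b)].
  rewrite eqEcard join // cards2 cd andbT.
  by apply/subsetP => b /set2P[] ->; rewrite inE ?cB ?dB ?pc ?qc ?pd ?qd.
by have : e \in [set c; d]; [rewrite pair inE eB pe qe | rewrite !inE].
Qed.

Lemma flag_block (f : flag B) : block f \in B.
Proof. by case/andP: (valP f). Qed.

Lemma flag_incidence (f : flag B) : point f \in block f.
Proof. by case/andP: (valP f). Qed.

Lemma flag_inj (f g : flag B) : point f = point g -> block f = block g -> f = g.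
Proof.
move=> pfg bfg; apply: val_inj.
by rewrite [LHS]surjective_pairing [RHS]surjective_pairing; congr pair.
Qed.

Lemma Gamma2_sym : symmetric (Gamma2 (B := B)).
Proof. by move=> f g; rewrite /Gamma2 setIC setUC. Qed.

(** A block has more than two points, hence is not the pair of points that
    adjacency requires as the intersection. *)
Lemma Gamma2_block (f g : flag B) : Gamma2 f g -> block f != block g.
Proof.
move=> /eqP fg; apply/eqP => bfg; have := nontrivial_block_size.
have [_ _ /(_ _ (flag_block f)) <- _] := designB.
by rewrite -[block f]setIid {2}bfg fg cards2; case: (_ != _).
Qed.

Lemma Gamma2_point (f g : flag B) : Gamma2 f g -> point f != point g.
Proof.
move=> fg; have := block_intersection designB k_gt1 (flag_block f) (flag_block g).
by move/(_ (Gamma2_block fg)); rewrite (eqP fg) cards2; case: (_ != _).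
Qed.

Lemma Gamma2_irr : irreflexive (Gamma2 (B := B)).
Proof. by move=> f; apply/negP => /Gamma2_block; rewrite eqxx. Qed.

Lemma Gamma2_mem (f g : flag B) :
  Gamma2 f g -> (point f \in block g) && (point g \in block f).
Proof.
move=> /eqP/setP fg.
have := fg (point f); have := fg (point g); rewrite !inE !eqxx orbT.
by move=> /andP[-> _] /andP[_ ->].
Qed.

(** The point of a neighbour with block [d] is the element of [block f :&: d]
    other than [point f]. *)
Lemma Gamma2_block_inj (f : flag B) :
  {in [set g | Gamma2 f g] &, injective (@block P B)}.
Proof.
move=> g h; rewrite !inE => fg fh bgh; apply: flag_inj => //.
have : point g \in [set point f; point h].
  by rewrite -(eqP fh) -bgh (eqP fg) set22.
by rewrite !inE eq_sym (negPf (Gamma2_point fg)) => /eqP.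
Qed.

Lemma Gamma2_neighbour_blocks (f : flag B) :
  [set block g | g in [set g | Gamma2 f g]] = [set d in B | point f \in d] :\ block f.
Proof.
apply/setP => d; rewrite !inE; apply/imsetP/and3P.
  move=> [g]; rewrite inE => fg ->; rewrite flag_block eq_sym Gamma2_block //.
  by case/andP: (Gamma2_mem fg).
move=> [dc dB pd].
have pcd : point f \in block f :&: d by rewrite inE flag_incidence pd.
have cd : block f != d by rewrite eq_sym.
have := block_intersection designB k_gt1 (flag_block f) dB cd.
rewrite (cardsD1 (point f)) pcd => -[/eqP/cards1P[q def_q]].
have fgI : block f :&: d = [set point f; q] by rewrite -def_q setD1K.
have /setIP[_ qd] : q \in block f :&: d by rewrite fgI set22.
have flag_qd : (d \in B) && (q \in d) by rewrite dB.
exists (exist _ (q, d) flag_qd) => //.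
by rewrite inE; apply/eqP.
Qed.

Lemma Gamma2_regular : regular (Gamma2 (B := B)) (k - 1).
Proof.
move=> f; rewrite -(card_in_imset (@Gamma2_block_inj f)) Gamma2_neighbour_blocks.
have := cardsD1 (block f) [set d in B | point f \in d].
by rewrite (point_degree designB k_gt1) inE flag_block flag_incidence => ->; rewrite addKn.
Qed.

(** The three blocks of a triangle would all pass through the points of the first
    two flags. *)
Lemma Gamma2_triangle_free (f g : flag B) :
  Gamma2 f g -> common_neighbours (Gamma2 (B := B)) f g = set0.
Proof.
move=> fg; apply/setP => h; rewrite !inE; apply/negP => /andP[fh gh].
have /andP[pfg pgf] := Gamma2_mem fg.
have /andP[pfh _] := Gamma2_mem fh; have /andP[pgh _] := Gamma2_mem gh.
have := third_block (Gamma2_point fg) (Gamma2_block fg)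
  (flag_block f) (flag_block g) (flag_block h)
  (flag_incidence f) pgf pfg (flag_incidence g) pfh pgh.
by rewrite ![block h == _]eq_sym (negPf (Gamma2_block fh)) (negPf (Gamma2_block gh)).
Qed.

(** The blocks of [f], [g] and of a common neighbour [h] would all pass through
    [point f] and [point h]. *)
Lemma Gamma2_same_point (f g : flag B) :
  f != g -> point f = point g -> common_neighbours (Gamma2 (B := B)) f g = set0.
Proof.
move=> fg pfg; apply/setP => h; rewrite !inE; apply/negP => /andP[fh gh].
have bfg : block f != block g.
  by apply: contraNneq fg => bfg; apply/eqP/flag_inj.
have /andP[pfh phf] := Gamma2_mem fh; have /andP[_ phg] := Gamma2_mem gh.
have pg : point f \in block g by rewrite pfg flag_incidence.
have := third_block (Gamma2_point fh) bfg
  (flag_block f) (flag_block g) (flag_block h)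
  (flag_incidence f) phf pg phg pfh (flag_incidence h).
by rewrite ![block h == _]eq_sym (negPf (Gamma2_block fh)) (negPf (Gamma2_block gh)).
Qed.

(** A common neighbour is determined by its block, which is one of the two blocks
    through the points of [f] and [g]. *)
Lemma Gamma2_distinct_points (f g : flag B) :
  point f != point g -> #|common_neighbours (Gamma2 (B := B)) f g| <= 2.
Proof.
have [_ _ _ join] := designB => /join <-.
rewrite -(card_in_imset (f := @block P B)); last first.
  move=> h h'; rewrite !inE => /andP[fh _] /andP[fh' _].
  by apply: (@Gamma2_block_inj f); rewrite inE.
apply/subset_leq_card/subsetP => d /imsetP[h]; rewrite inE => /andP[fh gh] ->.
have /andP[pfh _] := Gamma2_mem fh; have /andP[pgh _] := Gamma2_mem gh.
by rewrite inE flag_block pfh.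
Qed.

End Biplane.

Theorem theorem4 (P : finType) (B : {set {set P}}) (v k : nat)
    (biplaneD : biplane B v k) (nontrivialD : nontrivial v k) :
  qsrg (Gamma2 (B := B)) (v * k) (k - 1) 0 [:: 0; 1; 2].
Proof.
have [_ _ [_ blocks_card block_card _]] := biplaneD.
split.
- by split; [apply: Gamma2_sym | apply: (Gamma2_irr biplaneD nontrivialD)].
- by rewrite flag_card (eq_bigr (fun=> k)) // sum_nat_const blocks_card.
- exact: Gamma2_regular biplaneD nontrivialD.
- by move=> f g fg; rewrite (Gamma2_triangle_free biplaneD nontrivialD) // cards0.
- move=> f g fg _; have [pfg|pfg] := eqVneq (point f) (point g).
    by rewrite (Gamma2_same_point biplaneD nontrivialD) // cards0.
  have := Gamma2_distinct_points biplaneD nontrivialD pfg.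
  by rewrite !inE; case: #|_| => [|[|[]]].
Qed.
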